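(* Let $A,B\in\mathbb{C}^{n\times n}$. Then $$A^{(B)}=A^{(2)}_{R(BB^\dagger A^* ),\,N((AB)^* )}.$$
   Context: $R(M)$, $N(M)$, $M^*$, $M^\dagger$ denote the range, null space, conjugate transpose and Moore-Penrose inverse of a complex matrix $M$. For $A,B\in\mathbb{C}^{n\times n}$, the generalized inverse of $A$ with respect to $B$ is $A^{(B)}:=(ABB^\dagger)^\dagger$. For $A\in\mathbb{C}^{n\times n}$ of rank $r$ and subspaces $T,S\subset\mathbb{C}^n$ with $\dim T=t\le r$ and $\dim S=n-t$, $A^{(2)}_{T,S}$ denotes the unique matrix $X$ with $XAX=X$, range $T$ and null space $S$; it exists if and only if $A(T)\oplus S=\mathbb{C}^n$. *)

(* Defs.v *)
From HB Require Import structures.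
From mathcomp Require Import all_boot all_order all_algebra.
From mathcomp Require Import boolp classical_sets reals complex.

Set Implicit Arguments.
Unset Strict Implicit.
Unset Printing Implicit Defensive.

Import Order.TTheory GRing.Theory Num.Theory.
Local Open Scope ring_scope.
Local Open Scope sesquilinear_scope.

Section RangeNull.
Variables (F : fieldType).

(* MathComp's matrix library acts on row vectors; here matrices act on column
   vectors from the left. *)
Definition mxlfun m n (A : 'M[F]_(m, n)) : 'Hom('cV[F]_n, 'cV[F]_m) :=
  linfun (mulmx A).

Definition mxrange m n (A : 'M[F]_(m, n)) : {vspace 'cV[F]_m} :=
  limg (mxlfun A).

Definition mxnull m n (A : 'M[F]_(m, n)) : {vspace 'cV[F]_n} :=
  lker (mxlfun A).

Lemma mxlfunE m n (A : 'M[F]_(m, n)) v : mxlfun A v = A *m v.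
Proof. by rewrite lfunE. Qed.

Lemma mxrangeP m n (A : 'M[F]_(m, n)) y :
  reflect (exists x, y = A *m x) (y \in mxrange A).
Proof.
apply: (iffP memv_imgP) => [[x _ ->]|[x ->]]; exists x; rewrite ?mxlfunE //.
exact: memvf.
Qed.

Lemma mxnullP m n (A : 'M[F]_(m, n)) x :
  reflect (A *m x = 0) (x \in mxnull A).
Proof. by rewrite memv_ker mxlfunE; apply: eqP. Qed.

Lemma eq_mul_cV m n (A B : 'M[F]_(m, n)) :
  (forall v : 'cV_n, A *m v = B *m v) -> A = B.
Proof.
move=> eqAB; apply: trmx_inj; apply/row_matrixP => i.
by rewrite -!tr_col !colE eqAB.
Qed.

Lemma lfun_mx m n (g : 'Hom('cV[F]_n, 'cV[F]_m)) :
  exists X : 'M_(m, n), forall v, X *m v = g v.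
Proof.
exists (\matrix_(i, j) g (delta_mx j 0) i 0) => v.
rewrite {2}(matrix_sum_delta v) linear_sum.
under eq_bigr do rewrite big_ord1 linearZ /=.
apply/matrixP => i k; rewrite ord1 !mxE summxE.
by apply: eq_bigr => j _; rewrite !mxE mulrC.
Qed.

Lemma dim_cV n : \dim {:'cV[F]_n} = n.
Proof. by rewrite dimvf /dim /= muln1. Qed.

Lemma dim_mxrange_le m n (A : 'M[F]_(m, n)) : (\dim (mxrange A) <= \rank A)%N.
Proof.
have sub : (mxrange A <= mxrange (col_base A))%VS.
  apply/subvP => y /mxrangeP[x ->]; apply/mxrangeP; exists (row_base A *m x).
  by rewrite mulmxA mulmx_base.
apply: leq_trans (dimvS sub) _.
rewrite -[X in (_ <= X)%N]dim_cV.
by rewrite -(limg_ker_dim (mxlfun (col_base A)) fullv) leq_addl.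
Qed.

End RangeNull.

Section OuterInverse.
Variables (F : fieldType) (n : nat).
Implicit Types (A X : 'M[F]_n) (T S : {vspace 'cV[F]_n}).

Definition is_outer_inverse A T S X : Prop :=
  [/\ X *m A *m X = X, mxrange X = T & mxnull X = S].

(* The conditions under which A^(2)_{T,S} is defined. *)
Definition outer_admissible A T S : Prop :=
  [/\ (\dim T <= \rank A)%N,
      \dim S = (n - \dim T)%N,
      directv (mxlfun A @: T + S)
    & (mxlfun A @: T + S)%VS = fullv].

(* The matrix A^(2)_{T,S}, with default value 0 when it does not exist; see
   [outer_inverse_exists], [outer_inverse_uniq] and [outer_inverseP]. *)
Definition outer_inverse A T S : 'M[F]_n :=
  xget 0 [set X | is_outer_inverse A T S X]%classic.

Lemma outer_inverse_uniq A T S X Y :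
  is_outer_inverse A T S X -> is_outer_inverse A T S Y -> X = Y.
Proof.
move=> [XX RX NX] [YY RY NY].
have RYX : X *m A *m Y = Y.
  apply: eq_mul_cV => v; have : Y *m v \in mxrange X.
    by rewrite RX -RY; apply/mxrangeP; exists v.
  by case/mxrangeP => w Yv; rewrite -mulmxA Yv mulmxA XX.
rewrite -RYX; apply: eq_mul_cV => v; apply/eqP.
rewrite -subr_eq0 -!mulmxA -mulmxBr; apply/eqP.
apply/mxnullP; rewrite NX -NY; apply/mxnullP.
by rewrite mulmxBr !mulmxA YY subrr.
Qed.

Lemma outer_inverse_exists A T S :
  outer_admissible A T S <-> exists X, is_outer_inverse A T S X.
Proof.
have dimcV := dim_cV F n.
split=> [[_ dS dAS eAS]|[X [XX RX NX]]].
  have dT : (\dim T <= n)%N by rewrite -[X in (_ <= X)%N]dimcV dimvS ?subvf.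
  have dAT : \dim (mxlfun A @: T) = \dim T.
    move/directvP: dAS => /= /esym; rewrite eAS dimcV dS => E.
    by apply/eqP; rewrite -(eqn_add2r (n - \dim T)) E subnKC.
  have kT : (T :&: lker (mxlfun A))%VS = 0%VS.
    apply/eqP; rewrite -dimv_eq0; apply/eqP/(@addIn (\dim T)).
    by rewrite add0n -{1}dAT limg_ker_dim.
  have injT u v : u \in T -> v \in T -> A *m u = A *m v -> u = v.
    move=> uT vT e; apply/eqP; rewrite -subr_eq0 -memv0 -kT memv_cap.
    by rewrite memvB //=; apply/mxnullP; rewrite mulmxBr e subrr.
  have capAS : (mxlfun A @: T :&: S)%VS = 0%VS by apply/directv_addP.
  pose h := (mxlfun A \o projv T)%VF.
  pose g := (projv T \o (h^-1 \o daddv_pi (mxlfun A @: T) S))%VF.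
  have [X XE] := lfun_mx g.
  have gT v : g v \in T by rewrite comp_lfunE memv_proj.
  have decomp v : exists w s, [/\ w \in (mxlfun A @: T)%VS, s \in S & v = w + s].
    have : v \in (mxlfun A @: T + S)%VS by rewrite eAS memvf.
    by case/memv_addP => w wT [s sS ->]; exists w, s.
  have gS s : s \in S -> g s = 0.
    move=> sS; rewrite !comp_lfunE.
    have -> : daddv_pi (mxlfun A @: T) S s = 0.
      have := daddv_pi_add capAS (subvP (addvSr _ S) _ sS).
      have capSA : (S :&: mxlfun A @: T)%VS = 0%VS by rewrite capvC.
      rewrite (daddv_pi_id capSA sS) => E.
      by apply: (addIr s); rewrite E add0r.
    by rewrite !linear0.
  have agw w : w \in (mxlfun A @: T)%VS -> A *m g w = w.
    move=> wT; rewrite !comp_lfunE (daddv_pi_id capAS wT).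
    rewrite -mxlfunE -[LHS](comp_lfunE (mxlfun A) (projv T)) limg_lfunVK //.
    case/memv_imgP: wT => u uT ->; apply/memv_imgP; exists u; rewrite ?memvf //.
    by rewrite comp_lfunE projv_id.
  have gu u : u \in T -> g (A *m u) = u.
    move=> uT; apply: injT => //; rewrite agw // -mxlfunE.
    exact: memv_img.
  exists X; split.
  - apply: eq_mul_cV => v; have [w [s [wT sS ->]]] := decomp v.
    by rewrite -!mulmxA !XE linearD /= (gS s) // addr0 agw.
  - apply/vspaceP => v; apply/mxrangeP/idP => [[x ->]|vT]; first by rewrite XE.
    by exists (A *m v); rewrite XE gu.
  - apply/vspaceP => v; apply/mxnullP/idP => [|vS]; last by rewrite XE gS.
    have [w [s [wT sS ->]]] := decomp v.
    rewrite XE linearD /= (gS s) // addr0 => gw0.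
    by rewrite -(agw w wT) gw0 mulmx0 add0r.
have inj u : u \in T -> X *m (A *m u) = u.
  by rewrite -RX => /mxrangeP[x ->]; rewrite !mulmxA XX.
have kT : (T :&: lker (mxlfun A))%VS = 0%VS.
  apply/eqP; rewrite -subv0; apply/subvP => u; rewrite memv_cap => /andP[uT].
  by move/mxnullP => Au0; rewrite memv0 -(inj u uT) Au0 mulmx0.
have dAT := limg_dim_eq kT.
have capAS : (mxlfun A @: T :&: S)%VS = 0%VS.
  apply/eqP; rewrite -subv0; apply/subvP => v; rewrite memv_cap => /andP[].
  case/memv_imgP => u uT ->; rewrite mxlfunE -NX => /mxnullP.
  by rewrite inj // => ->; rewrite mulmx0 memv0.
split.
- rewrite -dAT; apply: leq_trans (dimvS (limgS _ (subvf T))) _.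
  exact: dim_mxrange_le.
- have: (\dim T + \dim S = n)%N.
    by rewrite -NX -RX addnC -[RHS]dimcV -(limg_ker_dim (mxlfun X) fullv) capfv.
  by move/(congr1 (subn^~ (\dim T))); rewrite addKn.
- exact/directv_addP.
apply/vspaceP => v; rewrite memvf; apply/memv_addP.
exists (A *m (X *m v)).
  by rewrite -mxlfunE memv_img // -RX; apply/mxrangeP; exists v.
exists (v - A *m (X *m v)); last by rewrite addrC subrK.
by rewrite -NX; apply/mxnullP; rewrite mulmxBr !mulmxA XX subrr.
Qed.

Lemma outer_inverseP A T S : outer_admissible A T S ->
  is_outer_inverse A T S (outer_inverse A T S).
Proof. by move/outer_inverse_exists => exX; apply: (xgetPex 0 exX). Qed.

End OuterInverse.

Section MoorePenrose.
Variable (C : numClosedFieldType).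

Definition is_mpinv m n (A : 'M[C]_(m, n)) (X : 'M[C]_(n, m)) : bool :=
  [&& A *m X *m A == A,
      X *m A *m X == X,
      (A *m X)^t* == A *m X
    & (X *m A)^t* == X *m A].

Lemma trmxC_mul m n p (A : 'M[C]_(m, n)) (B : 'M[C]_(n, p)) :
  (A *m B)^t* = B^t* *m A^t*.
Proof. by rewrite trmx_mul map_mxM. Qed.

Lemma mulmx_trmxC_eq0 m n (A : 'M[C]_(m, n)) : A *m A^t* = 0 -> A = 0.
Proof.
move=> AA0; apply/matrixP => i j; rewrite mxE.
have := congr1 (fun M : 'M_m => M i i) AA0; rewrite !mxE => /eqP.
rewrite psumr_eq0 => [/allP/(_ j)|k _]; last by rewrite !mxE mul_conjC_ge0.
by rewrite mem_index_enum !mxE mul_conjC_eq0 => /(_ isT)/eqP.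
Qed.

Lemma gram_unitmx m n (A : 'M[C]_(m, n)) : row_free A -> A *m A^t* \in unitmx.
Proof.
move=> Afree; rewrite -row_free_unit; apply: inj_row_free => v vAA.
have /mulmx_trmxC_eq0/eqP : (v *m A) *m (v *m A)^t* = 0.
  by rewrite trmxC_mul !mulmxA -(mulmxA v) vAA mul0mx.
by rewrite mulmx_free_eq0 // => /eqP.
Qed.

Lemma mpinv_full_rank m r n (F : 'M[C]_(m, r)) (G : 'M[C]_(r, n)) :
  row_full F -> row_free G -> exists X, is_mpinv (F *m G) X.
Proof.
move=> Ffull Gfree; pose P := G *m G^t*; pose Q := F^t* *m F.
have uP : P \in unitmx by apply: gram_unitmx.
have uQ : Q \in unitmx.
  have := @gram_unitmx _ _ (F^t*); rewrite trmxCK; apply.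
  by rewrite /row_free mxrank_map mxrank_tr.
have hP : P^t* = P by rewrite /P trmxC_mul trmxCK.
have hQ : Q^t* = Q by rewrite /Q trmxC_mul trmxCK.
have hPi : (invmx P)^t* = invmx P by rewrite trmx_inv map_invmx hP.
have hQi : (invmx Q)^t* = invmx Q by rewrite trmx_inv map_invmx hQ.
pose X := G^t* *m invmx P *m invmx Q *m F^t*.
have AX : F *m G *m X = F *m invmx Q *m F^t*.
  by rewrite /X !mulmxA -(mulmxA F) -/P mulmxK.
have XA : X *m (F *m G) = G^t* *m invmx P *m G.
  by rewrite /X !mulmxA -(mulmxA _ (F^t*)) -/Q mulmxKV.
exists X; apply/and4P; split; apply/eqP.
- by rewrite AX !mulmxA -(mulmxA _ (F^t*)) -/Q mulmxKV.
- by rewrite XA /X !mulmxA -(mulmxA _ G) -/P mulmxKV.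
- by rewrite AX !trmxC_mul trmxCK hQi mulmxA.
- by rewrite XA !trmxC_mul trmxCK hPi mulmxA.
Qed.

Lemma mpinv_exists m n (A : 'M[C]_(m, n)) : exists X, is_mpinv A X.
Proof.
have := mpinv_full_rank (col_base_full A) (row_base_free A).
by rewrite mulmx_base.
Qed.

Lemma mpinv_uniq m n (A : 'M[C]_(m, n)) X Y :
  is_mpinv A X -> is_mpinv A Y -> X = Y.
Proof.
case/and4P=> /eqP AXA /eqP XAX /eqP hAX /eqP hXA.
case/and4P=> /eqP AYA /eqP YAY /eqP hAY /eqP hYA.
have eAX : A *m X = A *m Y.
  rewrite -hAX; have -> : A *m X = A *m Y *m (A *m X) by rewrite mulmxA AYA.
  by rewrite trmxC_mul hAX hAY mulmxA AXA.
have eXA : X *m A = Y *m A.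
  rewrite -hXA; have -> : X *m A = X *m A *m (Y *m A).
    by rewrite mulmxA -2!(mulmxA X) AYA.
  by rewrite trmxC_mul hXA hYA mulmxA -2!(mulmxA Y) AXA.
by rewrite -XAX -mulmxA eAX mulmxA eXA YAY.
Qed.

Definition mpinv m n (A : 'M[C]_(m, n)) : 'M[C]_(n, m) :=
  xchoose (mpinv_exists A).

Lemma mpinvP m n (A : 'M[C]_(m, n)) : is_mpinv A (mpinv A).
Proof. exact: xchooseP. Qed.

(* The generalized inverse A^(B) of A with respect to B. *)
Definition geninv n (A B : 'M[C]_n) : 'M[C]_n := mpinv (A *m B *m mpinv B).

End MoorePenrose.

(* Main.v *)
Require Import Defs.
From mathcomp Require Import all_boot all_order all_algebra.
From mathcomp Require Import reals complex.
Local Open Scope ring_scope.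
Local Open Scope sesquilinear_scope.

(** Put [P = B B^+], the orthogonal projector onto the range of [B], and
[X = (A P)^+].  A Moore-Penrose inverse has the range and the null space of
the conjugate transpose ([mxrange_mpinv], [mxnull_mpinv]), here those of
[(A P)^* = P A^*].  The range is the prescribed one.  The null space is that
of [B^* A^* = (A B)^*], because [P] and [B^*] are left multiples of each
other: [P = (B^+)^* B^*] and [B^* = B^* P].  Finally the range of [X] lies in
that of [P], so [P X = X], and [X (A P) X = X] becomes [X A X = X].  Hence [X]
is an outer inverse of [A] with the prescribed range and null space; such a
matrix exists only for admissible subspaces and is unique. *)

Section RangeNullFactor.
Context {F : fieldType}.

Lemma mxrange_mulS m n p (A : 'M[F]_(m, n)) (B : 'M[F]_(n, p)) :
  (mxrange (A *m B) <= mxrange A)%VS.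
Proof.
apply/subvP => y /mxrangeP[x ->]; apply/mxrangeP; exists (B *m x).
by rewrite mulmxA.
Qed.

Lemma mxnull_mulS m n p (A : 'M[F]_(m, n)) (B : 'M[F]_(n, p)) :
  (mxnull B <= mxnull (A *m B))%VS.
Proof.
apply/subvP => x /mxnullP Bx0; apply/mxnullP.
by rewrite -mulmxA Bx0 mulmx0.
Qed.

End RangeNullFactor.

Section MoorePenroseTheory.
Context {C : numClosedFieldType}.

Section Penrose.
Context {m n : nat} (A : 'M[C]_(m, n)).

Lemma mulmx_mpinvK : A *m mpinv A *m A = A.
Proof. by case/and4P: (mpinvP A) => /eqP. Qed.

Lemma mpinv_mulmxK : mpinv A *m A *m mpinv A = mpinv A.
Proof. by case/and4P: (mpinvP A) => _ /eqP. Qed.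

Lemma mulmx_mpinv_herm : (A *m mpinv A)^t* = A *m mpinv A.
Proof. by case/and4P: (mpinvP A) => _ _ /eqP. Qed.

Lemma mpinv_mulmx_herm : (mpinv A *m A)^t* = mpinv A *m A.
Proof. by case/and4P: (mpinvP A) => _ _ _ /eqP. Qed.

(** [A^+ = A^* (A^+)^* A^+] and [A^* = A^+ A A^*]: each of [A^+] and [A^*] is
a right multiple of the other. *)
Lemma mxrange_mpinv : mxrange (mpinv A) = mxrange (A^t*).
Proof.
apply: subv_anti; apply/andP; split.
  by rewrite -{1}mpinv_mulmxK -mpinv_mulmx_herm trmxC_mul -mulmxA mxrange_mulS.
rewrite -{1}mulmx_mpinvK -mulmxA trmxC_mul mpinv_mulmx_herm -mulmxA.
exact: mxrange_mulS.
Qed.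

(** [A^+ = A^+ (A^+)^* A^*] and [A^* = A^* A A^+]: each of [A^+] and [A^*] is
a left multiple of the other. *)
Lemma mxnull_mpinv : mxnull (mpinv A) = mxnull (A^t*).
Proof.
apply: subv_anti; apply/andP; split.
  rewrite -{2}mulmx_mpinvK trmxC_mul mulmx_mpinv_herm mulmxA.
  exact: mxnull_mulS.
rewrite -{1}mpinv_mulmxK -mulmxA -mulmx_mpinv_herm trmxC_mul mulmxA.
exact: mxnull_mulS.
Qed.

(** Both sides are the vectors that [D] sends into the orthogonal complement
of the range of [A]. *)
Lemma mxnull_mulmx_mpinv p (D : 'M[C]_(m, p)) :
  mxnull (A *m mpinv A *m D) = mxnull (A^t* *m D).
Proof.
apply: subv_anti; apply/andP; split.
  rewrite -{3}mulmx_mpinvK trmxC_mul mulmx_mpinv_herm -(mulmxA (A^t*)).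
  exact: mxnull_mulS.
rewrite -mulmx_mpinv_herm trmxC_mul -(mulmxA _ (A^t*)).
exact: mxnull_mulS.
Qed.

End Penrose.

Lemma geninv_is_outer_inverse n (A B : 'M[C]_n) :
  is_outer_inverse A (mxrange (B *m mpinv B *m A^t*))
    (mxnull ((A *m B)^t*)) (geninv A B).
Proof.
have hM : (A *m B *m mpinv B)^t* = B *m mpinv B *m A^t*.
  by rewrite -mulmxA trmxC_mul mulmx_mpinv_herm.
have rX : mxrange (geninv A B) = mxrange (B *m mpinv B *m A^t*).
  by rewrite /geninv mxrange_mpinv hM.
split=> //; last first.
  by rewrite /geninv mxnull_mpinv hM mxnull_mulmx_mpinv trmxC_mul.
have PX : B *m mpinv B *m geninv A B = geninv A B.
  apply: eq_mul_cV => v.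
  have : geninv A B *m v \in mxrange (B *m mpinv B *m A^t*).
    by rewrite -rX; apply/mxrangeP; exists v.
  case/mxrangeP => w Xv.
  by rewrite -(mulmxA _ _ v) Xv !mulmxA mulmx_mpinvK.
rewrite -{2}PX -[RHS](mpinv_mulmxK (A *m B *m mpinv B)).
by rewrite /geninv !mulmxA.
Qed.

End MoorePenroseTheory.

Theorem theorem4p3 (R : realType) (n : nat)
    (A B : 'M[R[i] : numClosedFieldType]_n) :
  let T := mxrange (B *m mpinv B *m A^t*) in
  let S := mxnull ((A *m B)^t*) in
  outer_admissible A T S /\ geninv A B = outer_inverse A T S.
Proof.
move=> T S; have outX := geninv_is_outer_inverse n A B.
have adm : outer_admissible A T S.
  by apply/outer_inverse_exists; exists (geninv A B).
split=> //; exact: outer_inverse_uniq outX (outer_inverseP adm).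
Qed.
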